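(* There is a function $h:\sigma'\mathbb Q\to\omega$ such that for every ladder system $\mathbf C$ and every $\omega$-colouring $\mathbf f$ of $\mathbf C$ there is a special Aronszajn subtree $T\subseteq\sigma'\mathbb Q$ such that $h\upharpoonright T$ is a $\sigma'\mathbb Q$-uniformization of $\mathbf f$ (with domain $T$).
   Context: $\sigma\mathbb Q$ is the set of all subsets of $\mathbb Q$ which are well ordered by the usual order of $\mathbb Q$ and bounded above in $\mathbb Q$, ordered by end-extension ($s<t$ iff $s$ is a proper initial segment of $t$); it is a tree of height $\omega_1$. $\sigma'\mathbb Q$ is the subtree of those $t\in\sigma\mathbb Q$ which have a maximum. For a tree, $s\upharpoonright\xi$ is the predecessor of $s$ of height $\xi$. A subtree of a tree $U$ of height $\omega_1$ is a downward closed $S\subseteq U$ in which every node has extensions in $S$ of arbitrarily large countable height. A ladder system is $\mathbf C=(C_\alpha)_{\alpha\in\lim(\omega_1)}$ with $C_\alpha$ a cofinal subset of $\alpha$ of order type $\omega$; an $\omega$-colouring is $(f_\alpha)$ with $f_\alpha:C_\alpha\to\omega$. A map $\varphi$ defined on a subtree $S$ of $U$ is a $U$-uniformization of $\mathbf f$ if for every $s\in S$ of limit height $\alpha$ and all but finitely many $\xi\in C_\alpha$, $\varphi(s\upharpoonright\xi)=f_\alpha(\xi)$. An Aronszajn tree is a tree of height $\omega_1$ with countable levels and no uncountable chains; a tree is special if it is a countable union of antichains. *)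

(* Defs.v *)
From mathcomp Require Import all_boot all_order all_algebra.
From mathcomp Require Import all_classical.

Set Implicit Arguments.
Unset Strict Implicit.
Unset Printing Implicit Defensive.

Import Order.TTheory GRing.Theory Num.Theory.
Local Open Scope classical_set_scope.

Definition well_ordered (X : Type) (lt : X -> X -> Prop) (A : set X) : Prop :=
  forall B : set X, B `<=` A -> B !=set0 ->
    exists2 m, B m & forall x, B x -> m = x \/ lt m x.

Definition order_isomorphic (X Y : Type) (ltX : X -> X -> Prop)
    (ltY : Y -> Y -> Prop) (A : set X) (B : set Y) : Prop :=
  exists2 g : X -> Y, set_bij A B g &
    forall x y, A x -> A y -> (ltX x y <-> ltY (g x) (g y)).

(* A well-ordering of the uncountable type [set nat], chosen once and for all;
   the points with countably many predecessors form an initial segment of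
   order type omega_1. *)
Definition wo_set_nat : rel (set nat) :=
  sval (wochoice.well_ordering_principle (set nat)).

Definition omega1_set : set (set nat) :=
  [set x | countable [set y | wo_set_nat y x]].

Definition omega1 : Type := set_type omega1_set.

Definition olt (a b : omega1) : Prop := wo_set_nat (val a) (val b) /\ a <> b.

Lemma wo_set_natP (A : set (set nat)) : A !=set0 ->
  exists2 m, A m & forall x, A x -> wo_set_nat m x.
Proof.
move=> [x Ax]; have wo := svalP (wochoice.well_ordering_principle (set nat)).
have [|m [[/set_mem Am lem] _]] := wo [in A]; first by exists x; rewrite !inE.
by exists m => // y Ay; apply: lem; rewrite inE.
Qed.

Lemma wo_set_nat_refl x : wo_set_nat x x.
Proof.
have [|m -> h] := @wo_set_natP [set x]; first by exists x.
exact: h.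
Qed.

Lemma wo_set_nat_anti x y : wo_set_nat x y -> wo_set_nat y x -> x = y.
Proof.
move=> xy yx; have wo := svalP (wochoice.well_ordering_principle (set nat)).
have [|m [_ um]] := wo [in [set x; y]]; first by exists x; rewrite !inE; left.
rewrite -(um x) ?(um y)//; split; rewrite ?inE/=; [by right| |by left|];
  by move=> z; rewrite inE => -[]->//; apply: wo_set_nat_refl.
Qed.

Lemma wo_set_nat_total x y : wo_set_nat x y \/ wo_set_nat y x.
Proof.
have [|m [] -> h] := @wo_set_natP [set x; y]; first by exists x; left.
- by left; apply: h; right.
- by right; apply: h; left.
Qed.

Lemma wo_set_nat_trans y x z :
  wo_set_nat x y -> wo_set_nat y z -> wo_set_nat x z.
Proof.
move=> xy yz.
have [|m [[]|] -> h] := @wo_set_natP [set x; y; z]; first by exists x; left; left.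
- by apply: h; right.
- by have /(wo_set_nat_anti xy) -> : wo_set_nat y x by apply: h; left; left.
- have zx : wo_set_nat z x by apply: h; left; left.
  have zy : wo_set_nat z y by apply: h; left; right.
  by move: xy; rewrite (wo_set_nat_anti yz zy).
Qed.

Lemma olt_irrefl a : ~ olt a a.
Proof. by case. Qed.

Lemma olt_trans b a c : olt a b -> olt b c -> olt a c.
Proof.
move=> [ab nab] [bc nbc]; split; first exact: wo_set_nat_trans bc.
by move=> ac; apply: nab; apply: val_inj; apply: wo_set_nat_anti => //; rewrite ac.
Qed.

Lemma olt_total a b : [\/ olt a b, a = b | olt b a].
Proof.
have [->|/eqP ab] := eqVneq a b; first by constructor 2.
have [?|?] := wo_set_nat_total (val a) (val b); first by constructor 1.
by constructor 3; split=> // ba; apply: ab.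
Qed.

Lemma olt_wo : well_ordered olt setT.
Proof.
move=> B _ [b Bb].
have [|_ [m Bm <-] h] := @wo_set_natP (val @` B); first by exists (val b), b.
exists m => // x Bx; have [->|/eqP mx] := eqVneq m x; first by left.
by right; split=> //; apply: h; exists x.
Qed.

Lemma omega1_initial_countable (a : omega1) : countable [set x | olt x a].
Proof.
have /set_mem ca := valP a; rewrite /omega1_set/= in ca.
have sub : val @` [set x | olt x a] `<=` [set y | wo_set_nat y (val a)].
  by move=> _ [x [xa _] <-].
have : countable (val @` [set x | olt x a]).
  exact: sub_countable (subset_card_le sub) ca.
rewrite (eq_countable (inj_card_eq _)) // => x y _ _; exact: val_inj.
Qed.

Lemma omega1_uncountable : ~ countable [set: omega1].
Proof.
move=> c1.
have cS : countable omega1_set by rewrite -(eq_countable (card_setT _)).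
have [x nx] : ~` omega1_set !=set0.
  apply/set0P/eqP => /(congr1 setC); rewrite setCK setC0 => ST; move: cS.
  rewrite ST => /countable_injP[e ie].
  pose D : set nat := [set n | exists2 y, e y = n & ~ y n].
  have nD : ~ D (e D).
    by move=> D1; case: (D1) => y /ie; rewrite !inE => -> // nDe; apply: nDe.
  by apply: (nD); exists D.
have [|m nm h] := @wo_set_natP (~` omega1_set); first by exists x.
apply: nm; rewrite /omega1_set/=; have : countable (omega1_set `|` [set m]).
  by rewrite -bigcup2E; apply: bigcup_countable => // -[|[|k]] _ //=.
apply: sub_countable; apply: subset_card_le => y /= ym.
have [->|/eqP nym] := eqVneq y m; first by right.
left; apply: contrapT => ny; apply: nym; apply: wo_set_nat_anti => //.
exact: h.
Qed.

Definition limit_ordinal (a : omega1) : Prop :=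
  (exists x, olt x a) /\ forall x, olt x a -> exists2 y, olt x y & olt y a.

Section Trees.
Context {X : Type} (lt : X -> X -> Prop).
Implicit Types (S A : set X) (s t : X) (a : omega1).

Definition predecessors S t : set X := [set s | S s /\ lt s t].

Definition is_tree S : Prop :=
  [/\ forall t, S t -> ~ lt t t,
      forall s t u, S s -> S t -> S u -> lt s t -> lt t u -> lt s u
    & forall t, S t -> well_ordered lt (predecessors S t)].

Definition has_height S t a : Prop :=
  order_isomorphic olt lt [set x | olt x a] (predecessors S t).

Definition level S a : set X := [set t | S t /\ has_height S t a].

Definition height_omega1 S : Prop :=
  (forall t, S t -> exists a, has_height S t a) /\ (forall a, level S a !=set0).

Definition is_chain A : Prop :=
  forall s t, A s -> A t -> [\/ lt s t, s = t | lt t s].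

Definition is_antichain A : Prop := forall s t, A s -> A t -> ~ lt s t.

Definition aronszajn S : Prop :=
  [/\ is_tree S, height_omega1 S, forall a, countable (level S a)
    & forall A, A `<=` S -> is_chain A -> countable A].

Definition special S : Prop :=
  exists2 F : nat -> set X, S = \bigcup_n F n & forall n, is_antichain (F n).

(* The ambient tree is the whole type [X], and heights are taken in it. *)
Definition subtree S : Prop :=
  (forall s t, S t -> lt s t -> S s) /\
  (forall s, S s -> forall a, exists t b,
     [/\ S t, s = t \/ lt s t, has_height setT t b & a = b \/ olt a b]).

Definition is_restriction s (x : omega1) r : Prop :=
  lt r s /\ has_height setT r x.

End Trees.

(* Only the values at limit ordinals are meaningful. *)
Record ladder_system : Type := LadderSystem {
  ladder :> omega1 -> set omega1;
  ladder_sub : forall a, limit_ordinal a -> ladder a `<=` [set x | olt x a];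
  ladder_cofinal : forall a, limit_ordinal a ->
    forall x, olt x a -> exists2 y, ladder a y & x = y \/ olt x y;
  ladder_type : forall a, limit_ordinal a ->
    order_isomorphic (fun m n : nat => (m < n)%N) olt setT (ladder a) }.

Definition omega_colouring (C : ladder_system) : Type :=
  forall a : omega1, C a -> nat.

(* The quantifier over [r] only names the (unique) node [s] restricted to [x]. *)
Definition uniformization (X : Type) (lt : X -> X -> Prop)
    (C : ladder_system) (f : omega_colouring C)
    (S : set X) (phi : S -> nat) : Prop :=
  subtree lt S /\
  forall (s : S) (a : omega1), limit_ordinal a ->
    has_height lt setT (val s) a ->
    finite_set [set x : C a | ~ exists2 r : S,
      is_restriction lt (val s) (val x) (val r) & phi r = f a x].

Definition sigmaQ : set (set rat) :=
  [set t | well_ordered (fun x y : rat => (x < y)%R) t /\ has_ubound t].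

(* The empty set is excluded, so the roots are the singletons and a node of
   height [a] in this tree is a set of order type [a + 1]. *)
Definition sigmaQ' : set (set rat) :=
  [set t | sigmaQ t /\ exists2 m, t m & ubound t m].

Definition end_extension (s t : set rat) : Prop :=
  s `<` t /\ forall x y : rat, s x -> t y -> (y < x)%R -> s y.

Definition lt_sigmaQ' (s t : sigmaQ') : Prop := end_extension (val s) (val t).

(* Main.v *)
Require Import Defs.
From mathcomp Require Import all_boot all_order all_algebra.
From mathcomp Require Import all_classical.
From mathcomp Require Import archimedean lra zify.
Set Implicit Arguments.
Unset Strict Implicit.
Unset Printing Implicit Defensive.

Import Order.TTheory GRing.Theory Num.Theory.
Local Open Scope classical_set_scope.

(** Colour a node by its maximum, through a map [Q -> nat] all of whose fibres
are dense. The tree is built level by level, keeping the levels countable and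
keeping the property that a node [s] and a rational [q > max s] admit, at each
greater height, an extension of [s] with maximum [q]. At a limit [a] one climbs
along the ladder [C a]: since the fibres are dense, the maximum at each rung
can be given the colour prescribed by [f a] while staying below [q]. Any subset
of [sigmaQ'] is special, because [max] is strictly increasing. *)

(** * A colouring of the rationals with dense fibres *)

(** For nonzero [r] this is the negated 2-adic valuation, truncated at 0. *)
Definition dyadic_colour (r : rat) : nat :=
  (logn 2 `|denq r| - logn 2 `|numq r|)%N.

(** If [m] is [2 ^ n] times an odd number, then odd multiples of [1 / m] have colour [n]. They are
    spaced [2 / m] apart, so an interval longer than [3 / m] contains one. *)
Lemma dyadic_colour_dense (p q : rat) (n : nat) : (p < q)%R ->
  exists r, [/\ (p < r)%R, (r < q)%R & dyadic_colour r = n].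
Proof.
move=> pq; pose m := (2 ^ n * (2 * Num.bound (3 / (q - p))%R).+1)%N.
pose k := Num.floor (m%:R * p / 2)%R; pose j : int := (2 * (k + 1) + 1)%R.
have d0 : (0 < q - p)%R by rewrite subr_gt0.
have m0 : (0 < m%:R :> rat)%R by rewrite ltr0n muln_gt0 expn_gt0.
have mlarge : (3 < m%:R * (q - p))%R.
  rewrite -ltr_pdivrMr//; apply: (@lt_le_trans _ _ (Num.bound (3 / (q - p)))%:R%R).
    by apply: archi_boundP; rewrite divr_ge0// ltW.
  by rewrite ler_nat /m; have := expn_gt0 2 n; nia.
have /andP[kle klt] := floor_itv (m%:R * p / 2)%R; rewrite -/k in kle klt.
have jE : (j%:~R = 2 * k%:~R + 3 :> rat)%R.
  by rewrite /j !(rmorphD, rmorphM)/=; lra.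
exists (j%:~R / m%:R)%R; split.
- by rewrite ltr_pdivlMr// jE; move: klt; rewrite rmorphD /=; lra.
- by rewrite ltr_pdivrMr// jE; lra.
- set r := (j%:~R / m%:R)%R.
  have jodd : odd `|j| by rewrite /j; lia.
  have j0 : (0 < `|j|)%N by case: `|j|%N jodd.
  have eqN : (`|numq r| * m = `|j| * `|denq r|)%N.
    suff : (numq r * m%:Z = j * denq r)%R by move/(congr1 absz); rewrite !abszM.
    apply: (@intr_inj rat); rewrite [LHS]rmorphM [RHS]rmorphM/=.
    have := divq_num_den r; have : ((denq r)%:~R != 0 :> rat)%R.
      by rewrite intr_eq0 denq_neq0.
    move=> dn0 /(canRL (divfK dn0)) ->.
    by rewrite -pmulrn (mulrAC r) {1}/r divfK// gt_eqF.
  have d1 : (0 < `|denq r|)%N by rewrite absz_gt0 denq_neq0.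
  have n1 : (0 < `|numq r|)%N.
    have : (0 < `|j| * `|denq r|)%N by rewrite muln_gt0 j0.
    by rewrite -eqN muln_gt0 => /andP[].
  have odd0 x : odd x -> logn 2 x = 0%N.
    by move=> ox; rewrite lognE dvdn2 ox andbF.
  (* Comparing exponents of 2 in [eqN], where [j] is odd, shows that the denominator has exactly [n]
     more than the numerator. *)
  move: eqN => /(congr1 (logn 2)); rewrite lognM//; last by rewrite -(ltr_nat rat).
  rewrite lognM// (odd0 _ jodd) /m lognM ?expn_gt0//.
  rewrite pfactorK// (odd0 (2 * _).+1) ?addn0; last by rewrite oddS mul2n odd_double.
  by rewrite /dyadic_colour add0n => <-; rewrite addnC addnK.
Qed.

(** * Weak order and induction on [omega1] *)

Definition ole (a b : omega1) : Prop := a = b \/ olt a b.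

Lemma ole_olt_trans b a c : ole a b -> olt b c -> olt a c.
Proof. by move=> [->//|]; exact: olt_trans. Qed.

Lemma olt_ole_trans b a c : olt a b -> ole b c -> olt a c.
Proof. by move=> ab [<-//|]; exact: olt_trans. Qed.

Lemma ole_trans b a c : ole a b -> ole b c -> ole a c.
Proof. by move=> [->//|ab] bc; right; exact: olt_ole_trans bc. Qed.

Lemma ole_or_olt a b : ole a b \/ olt b a.
Proof. by have [ab|ab|ab] := olt_total a b; rewrite /ole; tauto. Qed.

Lemma olt_not_ole a b : olt a b -> ~ ole b a.
Proof. by move=> ab ba; exact: olt_irrefl (olt_ole_trans ab ba). Qed.

Lemma olt_wf : well_founded olt.
Proof.
move=> a; apply: contrapT => na.
have [m nm lem] := olt_wo (@subsetT _ [set x | ~ Acc olt x]) (ex_intro _ a na).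
apply: nm; constructor => y ym; apply: contrapT => ny.
by apply: (olt_not_ole ym); exact: lem.
Qed.

Lemma olt_ind (P : omega1 -> Prop) :
  (forall a, (forall b, olt b a -> P b) -> P a) -> forall a, P a.
Proof. by move=> IH a; elim: (olt_wf a) => {}a _ /IH. Qed.

(** * Increasing functions as codes for nodes *)

(** A node of height [b] is coded by a total function, of which only the values up to and including
    [b] matter; hence agreement replaces equality. *)
Definition agree_upto (b : omega1) (g g' : omega1 -> rat) : Prop :=
  forall x, ole x b -> g x = g' x.

Definition increasing_upto (a : omega1) (g : omega1 -> rat) : Prop :=
  forall x y, olt x y -> ole y a -> (g x < g y)%R.

Lemma increasing_upto_ole a g x y : increasing_upto a g ->
  ole x y -> ole y a -> (g x <= g y)%R.
Proof. by move=> inc [->//|xy] ya; rewrite ltW// inc. Qed.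

Lemma increasing_upto_sub a b g :
  increasing_upto a g -> ole b a -> increasing_upto b g.
Proof. by move=> inc ba x y xy yb; apply: inc => //; exact: ole_trans ba. Qed.

(** * Recursive construction of countable levels with the extension property *)

Section Levels.
Context (col : rat -> nat)
  (col_dense : forall (p q : rat) n, (p < q)%R ->
    exists r, [/\ (p < r)%R, (r < q)%R & col r = n]).
Context (C : ladder_system) (f : omega_colouring C).
Implicit Types (a b c : omega1) (g : omega1 -> rat)
  (M : omega1 -> set (omega1 -> rat)).

Definition admissible M a g : Prop :=
  [/\ increasing_upto a g,
      forall b, olt b a -> exists2 g', M b g' & agree_upto b g g'
    & limit_ordinal a -> finite_set [set x : C a | col (g (val x)) <> f x]].

(** Keeping a single extension for each [b], [g'] and [q] is what keeps the levels countable. The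
    default value is harmless, as [level_step] demands admissibility again. *)
Definition chosen M a b g' (q : rat) : omega1 -> rat :=
  xget (fun=> 0%R) [set g | [/\ admissible M a g, agree_upto b g g' & g a = q]].

(** The constant functions supply the roots: they are increasing up to [a] only when [a] is the
    least ordinal. *)
Definition level_step M a : set (omega1 -> rat) :=
  [set g | admissible M a g /\
    ((exists q, g = fun=> q) \/
     exists b g' q, [/\ olt b a, M b g' & g = chosen M a b g' q])].

(** Well-founded recursion gives earlier levels only along a proof of [olt b a]; the existential
    turns them into a family on all of [omega1], empty from [a] on. *)
Definition tree_level : omega1 -> set (omega1 -> rat) :=
  Fix olt_wf (fun=> set (omega1 -> rat))
    (fun a lev =>
      level_step (fun b => [set g | exists ba : olt b a, lev b ba g]) a).

(** [level_step] at [a] consults its family only below [a], where the truncated family and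
    [tree_level] coincide. *)
Lemma tree_levelE a : tree_level a = level_step tree_level a.
Proof.
rewrite {1}/tree_level Fix_eq => [|x lev lev' levE]; last first.
  congr (level_step _ x); apply/funext => b; apply/seteqP.
  by split=> g [bx]; exists bx; rewrite ?levE// -levE.
rewrite -/tree_level; set M := fun b : omega1 => _.
have ME b g : olt b a -> M b g = tree_level b g.
  by move=> ba; apply/propext; split=> [[]//|]; exists ba.
have admE : admissible M a = admissible tree_level a.
  apply/seteqP; split=> g [inc res lim]; split=> // b ba;
    by have [g' Mg' gg'] := res b ba; exists g' => //; rewrite ?ME// -ME.
rewrite /level_step /chosen admE; apply/seteqP; split=> g [adm [gq|]].
- by split=> //; left.
- move=> [b [g' [q [ba + ?]]]]; rewrite ME// => ?.
  by split=> //; right; exists b, g', q.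
- by split=> //; left.
- move=> [b [g' [q [ba + ?]]]]; rewrite -ME// => ?.
  by split=> //; right; exists b, g', q.
Qed.

Lemma tree_level_admissible a g : tree_level a g -> admissible tree_level a g.
Proof. by rewrite {1}tree_levelE => -[]. Qed.

Lemma tree_level_increasing a g : tree_level a g -> increasing_upto a g.
Proof. by move=> /tree_level_admissible[]. Qed.

Lemma tree_level_restrict a b g : tree_level a g -> ole b a ->
  exists2 g', tree_level b g' & agree_upto b g g'.
Proof.
move=> ag [->|ba]; first by exists g.
by have [_ + _] := tree_level_admissible ag; apply.
Qed.

(** Reduces extension within the levels to finding any admissible extension: the chosen one then has
    the same properties. *)
Lemma tree_level_chosen a b g' q :
    olt b a -> tree_level b g' ->
    (exists g, [/\ admissible tree_level a g, agree_upto b g g' & g a = q]) ->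
  exists g, [/\ tree_level a g, agree_upto b g g' & g a = q].
Proof.
move=> ba bg' /(xgetPex (fun=> 0%R)); rewrite -/(chosen _ a b g' q).
set g := chosen _ _ _ _ _ => -[adm gg' gq]; exists g; split=> //.
by rewrite tree_levelE; split=> //; right; exists b, g', q.
Qed.

(** By induction, only countably many triples [b], [g'], [q] occur below [a]. *)
Lemma tree_level_countable a : countable (tree_level a).
Proof.
elim/olt_ind: a => a IH.
have : countable (range (fun (q : rat) (_ : omega1) => q) `|`
    \bigcup_(b in [set b | olt b a]) \bigcup_(g' in tree_level b)
      range (chosen tree_level a b g')).
  rewrite -bigcup2E; apply: bigcup_countable => // -[|[|k]] _ //=.
    exact: sub_countable (card_image_le _ _) (countableP _).
  apply: bigcup_countable => [|b ba]; first exact: omega1_initial_countable.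
  by apply: bigcup_countable => [|g' _]; [exact: IH|exact: sub_countable (card_image_le _ _) (countableP _)].
apply: sub_countable; apply: subset_card_le => g; rewrite tree_levelE => -[_].
case=> [[q ->]|[b [g' [q [ba bg' ->]]]]]; first by left; exists q.
by right; exists b => //; exists g' => //; exists q.
Qed.

Lemma tree_level_zero a q : (forall b, ~ olt b a) -> tree_level a (fun=> q).
Proof.
move=> a0; rewrite tree_levelE; split; last by left; exists q.
split=> [x y xy ya|b /a0//|[[x /a0]]//].
by case: (a0 x); exact: olt_ole_trans ya.
Qed.

(** Continue [g'] by the value [q] beyond [c]; as [a] is the successor of [c], it is not a limit and
    no colour is prescribed there. *)
Lemma admissible_succ a c g' q : olt c a -> (forall x, olt x a -> ole x c) ->
    tree_level c g' -> (g' c < q)%R ->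
  exists g, [/\ admissible tree_level a g, agree_upto c g g' & g a = q].
Proof.
move=> ca succ cg' cq; pose g x := if pselect (ole x c) then g' x else q.
have gg' : agree_upto c g g' by move=> x xc; rewrite /g; case: pselect.
have gq : g a = q by rewrite /g; case: pselect => // ac; case: (olt_not_ole ca ac).
have inc := tree_level_increasing cg'.
exists g; split=> //; split=> [x y xy [ya|ya]|b ba|[_ /(_ c ca)[y cy ya]]].
- move: xy; rewrite ya gq => /succ xc; rewrite gg'//.
  by apply: le_lt_trans cq; apply: increasing_upto_ole inc _ _ => //; left.
- have yc := succ _ ya; rewrite !gg'//; first exact: inc.
  by right; exact: olt_ole_trans yc.
- have bc := succ _ ba; have [g2 bg2 g2g'] := tree_level_restrict cg' bc.
  by exists g2 => // x xb; rewrite -g2g'// gg'//; exact: ole_trans bc.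
- by have /(olt_not_ole cy) := succ _ ya.
Qed.

(* Climb along the ladder, choosing at each rung a rational of the prescribed
   colour below [q]; the union of the resulting branch is then capped by [q]. *)
Lemma admissible_limit a b g' q : limit_ordinal a -> olt b a ->
    (forall c, olt c a -> forall d g r, olt d c -> tree_level d g -> (g d < r)%R ->
      exists g2, [/\ tree_level c g2, agree_upto d g2 g & g2 c = r]) ->
    tree_level b g' -> (g' b < q)%R ->
  exists g, [/\ admissible tree_level a g, agree_upto b g g' & g a = q].
Proof.
move=> lima ba IH bg' bq.
have [u [uC uinj usurj] ult] := ladder_type C lima.
have {}uC n : C a (u n) by exact: uC.
have {}ult m n : (m < n)%N <-> olt (u m) (u n) by exact: ult.
have [_ /usurj[k _ <-] bk] := @ladder_cofinal C _ lima _ ba.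
(* Starting one rung past [u k] puts every [c n] strictly above [b]. *)
pose c n := u (k.+1 + n)%N.
have cS n : olt (c n) (c n.+1) by apply: (ult (k.+1 + n)%N (k.+1 + n.+1)%N).1; lia.
have ca n : olt (c n) a by exact: (@ladder_sub C _ lima _ (uC _)).
have bc0 : olt b (c 0%N) by apply: ole_olt_trans bk _; apply: (ult k%N (k.+1 + 0)%N).1; lia.
(* Invariant of the climb. The strict bound leaves room for the next rung and for the final value
   [q]. *)
pose P n g := [/\ tree_level (c n) g, (g (c n) < q)%R &
  forall x : C a, val x = c n -> col (g (c n)) = f x].
have extend d g n : olt d (c n) -> tree_level d g -> (g d < q)%R ->
    exists g2, P n g2 /\ agree_upto d g2 g.
  move=> dc dg dq; pose x0 : C a := SigSub (mem_set (uC (k.+1 + n)%N)).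
  have [r [dr rq colr]] := col_dense (f x0) dq.
  have [g2 [cg2 g2g g2c]] := IH _ (ca n) _ _ _ dc dg dr.
  exists g2; split=> //; split; rewrite ?g2c// => x xc.
  by rewrite (_ : x = x0)//; exact: val_inj.
have [g0 [Pg0 g0g']] := extend _ _ _ bc0 bg' bq.
(* By [extend], the invariant guarantees that the next choice exists, so the default [g] is never
   taken. *)
pose s := nat_rect (fun=> omega1 -> rat) g0
  (fun n g => xget g [set g2 | P n.+1 g2 /\ agree_upto (c n) g2 g]).
have sS n : P n (s n) -> P n.+1 (s n.+1) /\ agree_upto (c n) (s n.+1) (s n).
  by move=> [cs sq _]; exact: (xgetPex (s n) (extend _ _ n.+1 (cS n) cs sq)).
have Ps n : P n (s n) by elim: n => [//|n /sS[]].
have sagree m n : (m <= n)%N -> agree_upto (c m) (s n) (s m).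
  elim: n => [|n IHn]; first by rewrite leqn0 => /eqP ->.
  rewrite leq_eqVlt ltnS => /predU1P[->//|mn] x xm.
  have [_ ->] := sS _ (Ps n); first exact: IHn.
  apply: ole_trans xm _; move: mn; rewrite leq_eqVlt => /predU1P[->|mn].
    by left.
  by right; apply: (ult (k.+1 + m)%N (k.+1 + n)%N).1; lia.
have cof x : olt x a -> exists n, ole x (c n).
  move=> /(@ladder_cofinal C _ lima _)[_ /usurj[n _ <-] xn]; exists n; right.
  by apply: ole_olt_trans xn _; apply: (ult n%N (k.+1 + n)%N).1; lia.
(* The index picked for [x] is immaterial by [sagree]; no index exists at [a], which therefore gets
   [q]. *)
pose g x := if pselect (exists n, ole x (c n)) is left H
  then s (projT1 (cid H)) x else q.
have gs n : agree_upto (c n) g (s n).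
  move=> x xn; rewrite /g; case: pselect => [H|[]]; last by exists n.
  case: cid => m /= xm; have [mn|/ltnW nm] := leqP m n.
    by rewrite (sagree _ _ mn).
  by rewrite (sagree _ _ nm).
have ga : g a = q.
  by rewrite /g; case: pselect => // -[n an]; case: (olt_not_ole (ca n) an).
exists g; split=> //; last first.
  move=> x xb; have xc0 : ole x (c 0%N) by right; exact: ole_olt_trans bc0.
  by rewrite (gs 0%N) // -g0g'.
split=> [x y xy ya|d /cof[n dn]|_].
- have [n xn] : exists n, ole x (c n) by apply: cof; exact: olt_ole_trans ya.
  case: ya xy => [->|/cof[m ym]] xy.
    have [cs sq _] := Ps n; rewrite ga (gs n)//; apply: le_lt_trans sq.
    by apply: increasing_upto_ole (tree_level_increasing cs) _ _ => //; left.
  have [cs _ _] := Ps m; rewrite !(gs m)//; first exact: (tree_level_increasing cs).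
  by right; exact: olt_ole_trans ym.
- have [cs _ _] := Ps n; have [g2 dg2 sg2] := tree_level_restrict cs dn.
  by exists g2 => // x xd; rewrite -sg2// (gs n)//; exact: ole_trans dn.
(* Only the rungs [u 0] to [u k], skipped by the climb, can have a wrong colour. *)
- have : finite_set (val @^-1` (u @` `I_k.+1) : set (C a)).
    apply: finite_preimage; first by move=> x y _ _; exact: val_inj.
    exact: finite_image (finite_II _).
  apply: sub_finite_set => x /= ncol; have [n _ xn] := usurj _ (set_mem (valP x)).
  exists n => //=; rewrite ltnNge; apply/negP => kn; apply: ncol.
  have nE : val x = c (n - k.+1)%N by rewrite /c subnKC.
  by have [_ _ /(_ _ nE) <-] := Ps (n - k.+1)%N; rewrite nE (gs (n - k.+1)%N)//; left.
Qed.

(** Induction on [a]. At a successor of [c] with [b] below [c], first extend to [c] with a value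
    strictly between [g' b] and [q], then add [q]. *)
Lemma tree_level_extend a b g' q :
    olt b a -> tree_level b g' -> (g' b < q)%R ->
  exists g, [/\ tree_level a g, agree_upto b g g' & g a = q].
Proof.
elim/olt_ind: a b g' q => a IH b g' q ba bg' bq.
apply: tree_level_chosen => //.
have [lima|nlim] := pselect (limit_ordinal a); first exact: admissible_limit.
have [c ca succ] : exists2 c, olt c a & forall x, olt x a -> ole x c.
  apply: contrapT => nc; apply: nlim; split; first by exists b.
  move=> x xa; apply: contrapT => nx; apply: nc; exists x => // y ya.
  by have [//|xy] := ole_or_olt y x; case: nx; exists y.
have [bc|bc] := succ _ ba; first by rewrite bc in bg' bq *; exact: admissible_succ.
(* Density serves only to find an intermediate rational; the colour 0 is arbitrary. *)
have [r [br rq _]] := col_dense 0%N bq.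
have [g2 [cg2 g2g' g2c]] := IH _ ca _ _ _ bc bg' br.
have [|g [adm gg2 gq]] := @admissible_succ a c g2 q ca succ cg2.
  by rewrite g2c.
exists g; split=> // x xb; rewrite gg2 ?g2g'//.
by right; exact: ole_olt_trans bc.
Qed.

Lemma tree_level_nonempty a : tree_level a !=set0.
Proof.
have [z _ minz] := olt_wo (@subsetT _ [set: omega1]) (ex_intro _ a I).
have z0 b : ~ olt b z by move=> bz; apply: (olt_not_ole bz); exact: minz.
have zlev := tree_level_zero 0%R z0.
have [<-|za] := minz a I; first by exists (fun=> 0%R).
have [|g [ag _ _]] := @tree_level_extend a z _ 1%R za zlev; first by [].
by exists g.
Qed.

End Levels.

(** * Uniqueness of heights *)

(** Composing one isomorphism with the inverse of the other gives an order-preserving [k] from the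
    points below [b] to those below [a], so [k a] is below [a]. If [m] is least with [k m] below
    [m], then [k m] is a smaller such point. *)
Lemma has_height_not_olt (X : Type) (lt : X -> X -> Prop) (S : set X) t a b :
  has_height lt S t a -> has_height lt S t b -> ~ olt a b.
Proof.
move=> [u [_ _ usurj] ult] [v [vfun _ _] vlt] ab.
have /choice[k kP] x : exists y, olt x b -> olt y a /\ u y = v x.
  have [xb|nxb] := pselect (olt x b); last by exists x.
  by have [y ya uy] := usurj _ (vfun _ xb); exists y.
have [m [mb km] minm] := olt_wo
  (@subsetT _ [set x | olt x b /\ olt (k x) x])
  (ex_intro _ a (conj ab (proj1 (kP a ab)))).
have kb : olt (k m) b := olt_trans km mb.
have [kma ukm] := kP _ mb; have [kka ukk] := kP _ kb.
apply: (olt_not_ole km); apply: minm; split=> //.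
by apply/ult => //; rewrite ukm ukk; exact/vlt.
Qed.

Lemma has_height_unique (X : Type) (lt : X -> X -> Prop) (S : set X) t a b :
  has_height lt S t a -> has_height lt S t b -> a = b.
Proof.
by move=> ha hb; have [/(has_height_not_olt ha hb)|//|/(has_height_not_olt hb ha)]
  := olt_total a b.
Qed.

(** * End-extension and maxima in [sigmaQ'] *)

Lemma lt_sigmaQ'_irrefl t : ~ lt_sigmaQ' t t.
Proof. by move=> [[_ ntt] _]; exact: ntt. Qed.

Lemma lt_sigmaQ'_trans s t u :
  lt_sigmaQ' s t -> lt_sigmaQ' t u -> lt_sigmaQ' s u.
Proof.
move=> [[st nts] ist] [[tu nut] itu]; split.
  by split=> [x /st/tu//|us]; apply: nut => x /us/st.
by move=> x y sx uy yx; apply: (ist x) => //; apply: (itu x) => //; exact: st.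
Qed.

Definition sigmaQ'_max (t : sigmaQ') : rat :=
  xget 0%R [set m | val t m /\ ubound (val t) m].

Lemma sigmaQ'_maxP t :
  val t (sigmaQ'_max t) /\ ubound (val t) (sigmaQ'_max t).
Proof.
apply: (@xgetPex _ 0%R [set m | val t m /\ ubound (val t) m]).
by have [_ [m tm tum]] := set_mem (valP t); exists m.
Qed.

Lemma sigmaQ'_maxE t m : val t m -> ubound (val t) m -> sigmaQ'_max t = m.
Proof.
move=> tm um; have [tM uM] := sigmaQ'_maxP t.
by apply/eqP; rewrite eq_le um// uM.
Qed.

(** Otherwise every element of [t] is at most the maximum of [s], hence lies in [s] by
    end-extension, and the inclusion is not proper. *)
Lemma sigmaQ'_max_lt s t : lt_sigmaQ' s t -> (sigmaQ'_max s < sigmaQ'_max t)%R.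
Proof.
move=> [[st nts] ist]; have [sM uM] := sigmaQ'_maxP s.
have [_ utM] := sigmaQ'_maxP t.
rewrite ltNge; apply/negP => leM; apply: nts => y ty.
have : (y <= sigmaQ'_max s)%R by apply: le_trans leM; exact: utM.
by rewrite le_eqVlt => /predU1P[->//|]; exact: ist.
Qed.

(** The maximum is injective on a chain and takes rational values. *)
Lemma sigmaQ'_chain_countable (A : set sigmaQ') :
  is_chain lt_sigmaQ' A -> countable A.
Proof.
move=> chA; apply/countable_injP; exists (pickle \o sigmaQ'_max) => s t.
move=> /set_mem As /set_mem At /(pcan_inj pickleK) st.
by have [/sigmaQ'_max_lt|//|/sigmaQ'_max_lt] := chA _ _ As At; rewrite st ltxx.
Qed.

Lemma sigmaQ'_special (S : set sigmaQ') : special lt_sigmaQ' S.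
Proof.
exists (fun n => [set t | S t /\ pickle (sigmaQ'_max t) = n]).
  apply/seteqP; split=> [t St|t [n _ []]//].
  by exists (pickle (sigmaQ'_max t)).
move=> n s t [_ sn] [_ tn] /sigmaQ'_max_lt.
by rewrite (pcan_inj pickleK (etrans sn (esym tn))) ltxx.
Qed.

(** * Nodes as images of closed initial segments *)

(** The point [a] is included, so that for increasing [g] the image has maximum [g a] and is a node
    of height [a]. *)
Definition initial_image (a : omega1) (g : omega1 -> rat) : set rat :=
  g @` [set x | ole x a].

Lemma initial_image_agree a g g' :
  agree_upto a g g' -> initial_image a g = initial_image a g'.
Proof. by move=> gg'; apply: eq_imagel => x; exact: gg'. Qed.

Section InitialImage.
Context (a : omega1) (g : omega1 -> rat) (inc : increasing_upto a g).

Let le_mono x y : ole x y -> ole y a -> (g x <= g y)%R.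
Proof. exact: increasing_upto_ole. Qed.

Lemma increasing_upto_reflect x y :
  ole x a -> ole y a -> (g x <= g y)%R -> ole x y.
Proof.
move=> xa ya; have [//|yx] := ole_or_olt x y.
by rewrite leNgt inc.
Qed.

Lemma initial_image_sigmaQ' b : ole b a ->
  exists t : sigmaQ', val t = initial_image b g.
Proof.
move=> ba; suff sb : sigmaQ' (initial_image b g).
  by exists (SigSub (mem_set sb)).
have ub : ubound (initial_image b g) (g b) by move=> _ [x xb <-]; exact: le_mono.
split; last by exists (g b) => //; exists b => //; left.
split; last by exists (g b).
move=> B Bsub [_ /[dup] /Bsub[x xb <-] Bx].
have [m [Bm mb] minm] := olt_wo
  (@subsetT _ [set y | B (g y) /\ ole y b]) (ex_intro _ x (conj Bx xb)).
exists (g m) => // _ /[dup] /Bsub[y yb <-] By.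
have [->|my] := minm y (conj By yb); first by left.
by right; apply: inc => //; exact: ole_trans ba.
Qed.

Context (t : sigmaQ') (tE : val t = initial_image a g).

Lemma sigmaQ'_max_image : sigmaQ'_max t = g a.
Proof.
apply: sigmaQ'_maxE; rewrite tE; first by exists a => //; left.
by move=> _ [x xa <-]; apply: le_mono => //; left.
Qed.

(** The maximum of a predecessor [s] is some [g b], and end-extension forces [s] to contain every
    value up to it; [b] equal to [a] would give [s] equal to [t]. *)
Lemma lt_sigmaQ'_image s :
  lt_sigmaQ' s t <-> exists2 b, olt b a & val s = initial_image b g.
Proof.
split=> [[[st nts] ist]|[b ba sE]].
  have [sM uM] := sigmaQ'_maxP s.
  have := st _ sM; rewrite tE => -[b ba gb].
  have sE : val s = initial_image b g.
    apply/seteqP; split=> [y sy|_ [x xb <-]].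
      have := st _ sy; rewrite tE => -[x xa xy]; exists x => //.
      by apply: increasing_upto_reflect; rewrite // gb xy; exact: uM.
    have xa := ole_trans xb ba.
    have := le_mono xb ba; rewrite le_eqVlt => /predU1P[->|]; first by rewrite gb.
    by apply: ist; rewrite ?gb// tE; exists x.
  exists b => //; case: ba => // ba; case: nts.
  by rewrite sE tE ba.
have ba' : ole b a by right.
split; rewrite sE tE.
  split=> [_ [x xb <-]|]; first by exists x => //; exact: ole_trans ba'.
  move=> /(_ (g a)) []; first by exists a => //; left.
  move=> x xb /eqP; rewrite lt_eqF// inc//; last by left.
  exact: ole_olt_trans ba.
move=> _ _ [x xb <-] [y ya <-] yx; exists y => //; apply: (ole_trans _ xb).
by apply: increasing_upto_reflect => //; [exact: ole_trans ba'|exact: ltW].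
Qed.

End InitialImage.

(** Sending [x] below [a] to the node [initial_image x g] is an isomorphism onto the predecessors of
    [t]; injectivity is read off the maxima [g x]. *)
Lemma has_height_image a g (t : sigmaQ') : increasing_upto a g ->
  val t = initial_image a g -> has_height lt_sigmaQ' setT t a.
Proof.
move=> inc tE; have predP := lt_sigmaQ'_image inc tE.
pose u x := xget t [set s : sigmaQ' | val s = initial_image x g].
have uE x : olt x a -> val (u x) = initial_image x g.
  move=> xa; apply: (@xgetPex _ t [set s : sigmaQ' | val s = initial_image x g]).
  by apply: initial_image_sigmaQ' inc _ _; right.
have incx x : olt x a -> increasing_upto x g.
  by move=> xa; apply: increasing_upto_sub inc _; right.
have umax x : olt x a -> sigmaQ'_max (u x) = g x.
  by move=> xa; exact: (sigmaQ'_max_image (incx _ xa) (uE _ xa)).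
have u_lt x y : olt y a -> olt x y -> lt_sigmaQ' (u x) (u y).
  move=> ya xy; apply/(lt_sigmaQ'_image (incx _ ya) (uE _ ya)).
  by exists x => //; apply: uE; exact: olt_trans ya.
exists u.
  split=> [x xa|x y /set_mem xa /set_mem ya|s [_ /predP[x xa sE]]].
  - by split=> //; apply/predP; exists x => //; exact: uE.
  - move=> /(congr1 sigmaQ'_max); rewrite !umax// => gxy.
    have [xy|//|yx] := olt_total x y.
      by have := inc _ _ xy (or_intror ya); rewrite gxy ltxx.
    by have := inc _ _ yx (or_intror xa); rewrite gxy ltxx.
  - by exists x => //; apply: val_inj; rewrite uE.
move=> x y xa ya; split=> [|uxy]; first exact: u_lt.
have [//|xy|yx] := olt_total x y.
  by case: (@lt_sigmaQ'_irrefl (u x)); rewrite {2}xy.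
by case: (@lt_sigmaQ'_irrefl (u x)); apply: lt_sigmaQ'_trans uxy (u_lt _ _ xa yx).
Qed.

(** Lets heights in a downward closed set be computed in the ambient tree. *)
Lemma predecessors_downward_closed (X : Type) (lt : X -> X -> Prop) (S : set X) t :
  (forall s, lt s t -> S s) -> predecessors lt S t = predecessors lt setT t.
Proof.
by move=> Sdown; apply/seteqP; split=> s [_ st]; split=> //; exact: Sdown.
Qed.

(** * The Aronszajn subtree coded by the levels *)

Section LevelTree.
Context (col : rat -> nat)
  (col_dense : forall (p q : rat) n, (p < q)%R ->
    exists r, [/\ (p < r)%R, (r < q)%R & col r = n]).
Context (C : ladder_system) (f : omega_colouring C).

Local Notation lev := (tree_level col f).

Definition level_tree : set sigmaQ' :=
  [set t | exists a g, lev a g /\ val t = initial_image a g].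

Local Notation T := level_tree.

Lemma level_tree_node a g : lev a g ->
  exists t, [/\ T t, val t = initial_image a g & has_height lt_sigmaQ' setT t a].
Proof.
move=> ag; have inc := tree_level_increasing ag.
have [|t tE] := initial_image_sigmaQ' inc (b := a); first by left.
by exists t; split=> //; [exists a, g|exact: has_height_image tE].
Qed.

Lemma level_tree_down s t : T t -> lt_sigmaQ' s t -> T s.
Proof.
move=> [a [g [ag tE]]] /(lt_sigmaQ'_image (tree_level_increasing ag) tE)[b ba sE].
have [g' bg' gg'] := tree_level_restrict ag (or_intror ba).
by exists b, g'; rewrite sE (initial_image_agree gg').
Qed.

Lemma level_tree_height t a :
  T t -> has_height lt_sigmaQ' T t a = has_height lt_sigmaQ' setT t a.
Proof.
move=> Tt; rewrite /has_height predecessors_downward_closed// => s.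
exact: level_tree_down.
Qed.

(** Uniqueness of height identifies the level coding [t] with its given height. *)
Lemma level_tree_levelP t a : T t -> has_height lt_sigmaQ' setT t a ->
  exists2 g, lev a g & val t = initial_image a g.
Proof.
move=> [b [g [bg tE]]] ta; exists g;
  by rewrite (has_height_unique ta (has_height_image (tree_level_increasing bg) tE)).
Qed.

Lemma level_tree_subtree : subtree lt_sigmaQ' T.
Proof.
split=> [s t|s Ts a]; first exact: level_tree_down.
have [b [g [bg sE]]] := Ts; have inc := tree_level_increasing bg.
have [ab|ba] := ole_or_olt a b.
  by exists s, b; split=> //; [left|exact: has_height_image sE].
(* Any rational above [g b] can serve as the new maximum. *)
have lt1 : (g b < g b + 1)%R by rewrite ltrDl.
have [g2 [ag2 g2g _]] := tree_level_extend col_dense ba bg lt1.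
have [t [Tt tE ta]] := level_tree_node ag2.
exists t, a; split=> //; last by left.
right; apply/(lt_sigmaQ'_image (tree_level_increasing ag2) tE); exists b => //.
by rewrite sE; apply: initial_image_agree => x xb; rewrite g2g.
Qed.

Lemma level_tree_is_tree : is_tree lt_sigmaQ' T.
Proof.
split=> [t _|s t u _ _ _|t [a [g [ag tE]]] B Bsub [s Bs]].
- exact: lt_sigmaQ'_irrefl.
- exact: lt_sigmaQ'_trans.
have predP := lt_sigmaQ'_image (tree_level_increasing ag) tE.
have [_ /predP[x xa sE]] := Bsub _ Bs.
have [m [ma [r Br rE]] minm] := olt_wo
  (@subsetT _ [set y | olt y a /\ exists2 r, B r & val r = initial_image y g])
  (ex_intro _ x (conj xa (ex_intro2 _ _ s Bs sE))).
exists r => // r' Br'; have [_ /predP[y ya r'E]] := Bsub _ Br'.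
have [my|my] := minm y (conj ya (ex_intro2 _ _ r' Br' r'E)).
  by left; apply: val_inj; rewrite rE r'E my.
have inc : increasing_upto y g.
  by apply: increasing_upto_sub (tree_level_increasing ag) _; right.
by right; apply/(lt_sigmaQ'_image inc r'E); exists m.
Qed.

Lemma level_tree_aronszajn : aronszajn lt_sigmaQ' T.
Proof.
split; first exact: level_tree_is_tree.
- split=> [t Tt|a].
    have [a [g [ag tE]]] := Tt; exists a; rewrite level_tree_height//.
    exact: (has_height_image (tree_level_increasing ag) tE).
  have [g ag] := tree_level_nonempty col_dense f a.
  have [t [Tt _ ta]] := level_tree_node ag.
  by exists t; split=> //; rewrite level_tree_height.
- move=> a; have : countable (initial_image a @` lev a).
    exact: sub_countable (card_image_le _ _) (tree_level_countable _ _ _).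
  move=> cI; have : countable (val @` level lt_sigmaQ' T a).
    apply: sub_countable cI; apply: subset_card_le => _ [t [Tt +] <-].
    by rewrite level_tree_height// => /(level_tree_levelP Tt)[g ag ->]; exists g.
  by rewrite (eq_countable (inj_card_eq _)) // => x y _ _; exact: val_inj.
- by move=> A _; exact: sigmaQ'_chain_countable.
Qed.

(** For a node coded by [g], its restriction to a rung [x] has maximum [g x], so the exceptional
    rungs lie in the finite set allowed by admissibility at [a]. *)
Lemma level_tree_uniformization :
  uniformization lt_sigmaQ' f (sigL T (col \o sigmaQ'_max)).
Proof.
split=> [|s a lima ha]; first exact: level_tree_subtree.
have Ts : T (val s) := set_mem (valP s).
have [g ag sE] := level_tree_levelP Ts ha.
have [inc _ /(_ lima)] := tree_level_admissible ag.
apply: sub_finite_set => x /= nx colx; apply: nx.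
have xa : olt (val x) a := ladder_sub lima (set_mem (valP x)).
have xle : ole (val x) a by right.
have [g' xg' gg'] := tree_level_restrict ag xle.
have [r [Tr rE rx]] := level_tree_node xg'.
exists (SigSub (mem_set Tr)) => /=.
  split=> //; apply/(lt_sigmaQ'_image inc sE); exists (val x) => //.
  by rewrite rE (initial_image_agree gg').
rewrite (sigmaQ'_max_image (tree_level_increasing xg') rE) -colx gg'//.
by left.
Qed.

End LevelTree.

Theorem mainTheorem10 :
  exists h : sigmaQ' -> nat,
    forall (C : ladder_system) (f : omega_colouring C),
      exists T : set sigmaQ',
        [/\ subtree lt_sigmaQ' T, aronszajn lt_sigmaQ' T, special lt_sigmaQ' T
          & uniformization lt_sigmaQ' f (sigL T h)].
Proof.
exists (dyadic_colour \o sigmaQ'_max) => C f.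
exists (level_tree dyadic_colour f); split.
- exact: (level_tree_subtree dyadic_colour_dense).
- exact: (level_tree_aronszajn dyadic_colour_dense).
- exact: sigmaQ'_special.
- exact: (level_tree_uniformization dyadic_colour_dense).
Qed.
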